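(* Let $G$ be a group with identity $e$ and let $R$ be a weakly $G$-graded domain. If $(R,G)$ is invertible, i.e. $R_e$ is a field, then $R$ is first strongly $G$-graded, i.e. $1\in R_gR_{g^{-1}}$ for every $g\in supp(R,G)$.
   Context: A ring $R$ with unity $1$ is $G$-graded if $R=\bigoplus_{g\in G}R_g$ for additive subgroups $R_g$ with $R_gR_h\subseteq R_{gh}$ for all $g,h\in G$ (so $1\in R_e$). Here $R_gR_h$ denotes the additive subgroup generated by the products $ab$, $a\in R_g$, $b\in R_h$. $supp(R,G)=\{g\in G: R_g\neq\{0\}\}$. $(R,G)$ is weak (weakly graded) if $R_g=\{0\}$ implies $R_{g^{-1}}=\{0\}$, for all $g\in G$. A domain is a nonzero ring without zero divisors. $(R,G)$ is invertible if the identity component $R_e$ is a field. *)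

(* Defs.v *)
From HB Require Import structures.
From mathcomp Require Import all_boot all_order all_algebra.
From mathcomp Require Import boolp classical_sets functions cardinality fsbigop.

Set Implicit Arguments.
Unset Strict Implicit.
Unset Printing Implicit Defensive.

Import GRing.Theory.

Local Open Scope classical_set_scope.
Local Open Scope ring_scope.

(* Rings are unital but not assumed commutative. *)
Definition is_domain (R : pzRingType) : Prop :=
  (1 : R) <> 0 /\ forall x y : R, x * y = 0 -> x = 0 \/ y = 0.

Definition additive_subgroup (R : pzRingType) (A : set R) : Prop :=
  GRing.zmod_closed [in A].

(* The product of two components is the additive subgroup generated by the
   elementwise products, not just the set of those products. *)
Definition mul_subgroup (R : pzRingType) (A B : set R) : set R :=
  smallest (@additive_subgroup R) [set x | exists2 a, A a & exists2 b, B b & x = a * b].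

(* Internal direct sum: every element is uniquely a finitely supported sum of
   homogeneous components.  The finiteness clause is needed because a finitely
   supported sum over an infinite support is 0 by convention. *)
Definition direct_sum (I : choiceType) (R : pzRingType) (A : I -> set R) : Prop :=
  forall x : R, exists! f : I -> R,
    [/\ forall i, A i (f i),
        finite_set [set i | f i <> 0] &
        x = \sum_(i \in [set: I]) f i].

Definition grading (G : groupType) (R : pzRingType) (A : G -> set R) : Prop :=
  [/\ forall g, additive_subgroup (A g),
      direct_sum A &
      forall g h, mul_subgroup (A g) (A h) `<=` A (g * h)%g].

Definition grading_supp (G : groupType) (R : pzRingType) (A : G -> set R) : set G :=
  [set g | A g <> [set 0]].

Definition weakly_graded (G : groupType) (R : pzRingType) (A : G -> set R) : Prop :=
  forall g, A g = [set 0] -> A (g^-1)%g = [set 0].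

(* K is a field for the operations and the unit of R.  For K the identity
   component of a grading the subring clause holds automatically. *)
Definition is_subfield (R : pzRingType) (K : set R) : Prop :=
  [/\ GRing.subring_closed [in K],
      (1 : R) <> 0,
      forall x y, K x -> K y -> x * y = y * x &
      forall x, K x -> x <> 0 -> exists2 y, K y & x * y = 1].

Definition invertible_grading (G : groupType) (R : pzRingType) (A : G -> set R) : Prop :=
  is_subfield (A 1%g).

Definition first_strongly_graded (G : groupType) (R : pzRingType) (A : G -> set R) : Prop :=
  forall g, grading_supp A g -> mul_subgroup (A g) (A (g^-1)%g) 1.

(* Main.v *)
(** Nonzero elements [a] of degree [g] and [b] of degree [g^-1] have a nonzero
    product in the field [R_e]; if [y] is its inverse there, then
    [1 = a (b y)] with [b y] again of degree [g^-1]. *)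
Require Import Defs.
From mathcomp Require Import all_boot all_order all_algebra.
From mathcomp Require Import boolp classical_sets.

Lemma mul_subgroup_mul (R : pzRingType) (A B : set R) (a b : R) :
  A a -> B b -> mul_subgroup A B (a * b)%R.
Proof.
move=> Aa Bb; apply: sub_gen_smallest.
by exists a => //; exists b.
Qed.

(** A subgroup contains [0], so it can differ from [[set 0]] only by a nonzero element, which is
    extracted classically. *)
Lemma additive_subgroup_neq0 (R : pzRingType) (A : set R) :
  additive_subgroup A -> A <> [set 0%R]%classic -> exists2 a, A a & a <> 0%R.
Proof.
move=> [A0 _] Aneq; apply: contrapT => Aall0; apply: Aneq.
apply/seteqP; split=> [x Ax | _ ->]; last by rewrite inE in A0.
by apply: contrapT => x0; apply: Aall0; exists x.
Qed.

Theorem proposition3p10 (G : groupType) (R : pzRingType) (A : G -> set R)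
    (hgrading : grading A) (hweak : weakly_graded A) (hdomain : is_domain R)
    (hinv : invertible_grading A) :
  first_strongly_graded A.
Proof.
move=> g suppg.
have [subA _ mulA] := hgrading; have [_ integral] := hdomain.
have [_ _ _ inv1] := hinv.
(* Elementwise form of the grading axiom, which is stated for generated subgroups. *)
have Amul h k a b : A h a -> A k b -> A (h * k)%g (a * b)%R.
  by move=> Aa Ab; apply: mulA; apply: mul_subgroup_mul.
(* If this component vanished, weakness at [g^-1] would kill the component at [(g^-1)^-1 = g],
   against [suppg]. *)
have suppV : A (g^-1)%g <> [set 0%R]%classic.
  by move=> /hweak; rewrite invgK.
have [a Aa a0] := additive_subgroup_neq0 _ _ (subA g) suppg.
have [b Ab b0] := additive_subgroup_neq0 _ _ (subA _) suppV.
have Aab : A 1%g (a * b)%R by rewrite -(mulgV g); apply: Amul.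
have ab0 : (a * b)%R <> 0%R by move=> /integral [].
have [y Ay aby] := inv1 _ Aab ab0.
rewrite -aby -GRing.mulrA; apply: mul_subgroup_mul => //.
by rewrite -[(g^-1)%g]mulg1; apply: Amul.
Qed.
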